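(* Let $K>1$, $\theta\in(-\pi/2,\pi/2]$ and $c\in\mathbb{C}$. Then, for all $z\in\mathbb{C}$, $$G_c(z)=\lim_{n\to\infty}2^{-n}\log^+|f_c^n(z)|.$$
   Context: Let $h(z)=\frac{K+1}{2}z+e^{2i\theta}\frac{K-1}{2}\overline{z}$ (real-linear stretch by factor $K$ in the direction $e^{i\theta}$). For $c\in\mathbb{C}$ let $f_c(z)=h(z)^2+c$, with iterates $f_c^n$. Set $I(f_c)=\{z: f_c^n(z)\to\infty\}$ and $BO(f_c)=\mathbb{C}\setminus I(f_c)$. $\log^+x=\max\{\log x,0\}$ (with $\log^+0=0$). Böttcher coordinate $\psi_c$ (known, Fletcher–Fryer): near infinity put $\psi_0=\mathrm{id}$ and $\psi_{k+1}=f_0^{-1}\circ\psi_k\circ f_c$, the branch of $f_0^{-1}$ being chosen so that $\psi_{k+1}(z)=z+o(1)$ as $|z|\to\infty$. The sequence $(\psi_k)$ converges uniformly on a neighbourhood of infinity to a quasiconformal map $\psi_c$ with $\psi_c\circ f_c=f_0\circ\psi_c$ there. Green's function (known, Broderius–Fletcher): for each $\phi$ the ray $\{te^{i\phi}:t\ge0\}$ meets $\partial I(f_0)$ in exactly one point $b_{K,\theta}(\phi)$. $G_0(z)=\log(|z|/|b_{K,\theta}(\arg z)|)$ for $z\in I(f_0)$ and $G_0=0$ on $BO(f_0)$. For general $c$, $G_c=G_0\circ\psi_c$ in a neighbourhood of infinity, extended to $I(f_c)$ by $G_c(f_c(z))=2G_c(z)$, and $G_c=0$ on $BO(f_c)$.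 $G_c:\mathbb{C}\to[0,\infty)$ is continuous, positive exactly on $I(f_c)$, and $G_c\circ f_c=2G_c$ on $\mathbb{C}$. *)

(* Defs.v *)
From Stdlib Require Export Reals.
From Stdlib Require Import ClassicalEpsilon.
From Coquelicot Require Export Coquelicot.
Open Scope R_scope.

(** e^{i t} *)
Definition cis (t : R) : C := (cos t, sin t).

Definition h (K theta : R) (z : C) : C :=
  (RtoC ((K + 1) / 2) * z + cis (2 * theta) * RtoC ((K - 1) / 2) * Cconj z)%C.

Definition f (K theta : R) (c z : C) : C := (h K theta z * h K theta z + c)%C.

Definition f_iter (K theta : R) (c : C) (n : nat) (z : C) : C :=
  Nat.iter n (f K theta c) z.

(** I(f_c); BO(f_c) is its complement. *)
Definition escaping (K theta : R) (c z : C) : Prop :=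
  is_lim_seq (fun n => Cmod (f_iter K theta c n z)) p_infty.

Definition boundary (S : C -> Prop) (z : C) : Prop :=
  forall P : C -> Prop, locally z P ->
    (exists w, P w /\ S w) /\ (exists w, P w /\ ~ S w).

Definition on_ray (phi : R) (z : C) : Prop :=
  exists t : R, 0 <= t /\ z = (RtoC t * cis phi)%C.

(** The point b_{K,theta}(phi) where the ray of argument [phi] meets the
    boundary of I(f_0); this point exists and is unique for K > 1. *)
Definition b (K theta phi : R) : C :=
  epsilon (inhabits (RtoC 0))
    (fun p => on_ray phi p /\ boundary (escaping K theta (RtoC 0)) p).

(** Principal argument in (-PI, PI]; irrelevant value at 0. *)
Definition Arg (z : C) : R :=
  if Rle_dec 0 (Im z) then acos (Re z / Cmod z) else - acos (Re z / Cmod z).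

Definition G0 (K theta : R) (z : C) : R :=
  if excluded_middle_informative (escaping K theta (RtoC 0) z)
  then ln (Cmod z / Cmod (b K theta (Arg z)))
  else 0.

(** [psi] is (on some neighbourhood |z| > r of infinity) the Boettcher
    coordinate of f_c: the uniform limit of psi_0 = id and
    psi_{k+1} = f_0^{-1} o psi_k o f_c, with the continuous branch of f_0^{-1}
    for which psi_{k+1}(z) = z + o(1).  The neighbourhood is forward invariant,
    so that psi_k o f_c makes sense on it.  That [psi] is quasiconformal and
    conjugates f_c to f_0 is a consequence, not part of the definition. *)
Definition boettcher (K theta : R) (c : C) (psi : C -> C) : Prop :=
  exists (r : R) (psis : nat -> C -> C),
    0 < r /\
    (forall z, r < Cmod z -> r < Cmod (f K theta c z)) /\
    (forall z, r < Cmod z -> psis O z = z) /\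
    (forall k z, r < Cmod z ->
       f K theta (RtoC 0) (psis (S k) z) = psis k (f K theta c z)) /\
    (forall k z, r < Cmod z -> continuous (psis k) z) /\
    (forall k (eps : R), 0 < eps -> exists M : R, forall z,
       r < Cmod z -> M < Cmod z -> Cmod (psis (S k) z - z)%C < eps) /\
    (forall eps : R, 0 < eps -> exists N : nat, forall k z,
       (N <= k)%nat -> r < Cmod z -> Cmod (psis k z - psi z)%C < eps).

(** [G] is the Green's function G_c built from the Boettcher coordinate [psi]. *)
Definition green (K theta : R) (c : C) (psi : C -> C) (G : C -> R) : Prop :=
  (exists r : R, forall z, r < Cmod z -> G z = G0 K theta (psi z)) /\
  (forall z, escaping K theta c z -> G (f K theta c z) = 2 * G z) /\
  (forall z, ~ escaping K theta c z -> G z = 0).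

(** log^+; Stdlib's [ln] satisfies [ln 0 = 0], so [log_plus 0 = 0]. *)
Definition log_plus (x : R) : R := Rmax (ln x) 0.

(* Main.v *)
(** Since [h] satisfies [|z| <= |h z| <= K |z|], each ray meets the boundary of
    the escaping set of [f_0] at modulus between [K^-2] and [2], and therefore
    [G0 w = ln |w| + O(1)] near infinity.  The Boettcher coordinate moves points
    by a bounded amount, so [G w = ln |w| + O(1)] near infinity as well.
    Evaluating at [w = f_c^n(z)], where [G] equals [2^n G(z)], and dividing by
    [2^n] kills the bounded error.  A non-escaping orbit never leaves the disc
    of radius [2 + |c|], so there the limit is [0]. *)
Require Import Defs.
From Stdlib Require Import Lra Lia Classical ClassicalEpsilon.

(** * Moduli, neighbourhoods in the plane and a squeeze argument *)

Lemma Cmod_cis (t : R) : Cmod (cis t) = 1.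
Proof.
  unfold Cmod, cis; simpl.
  replace (cos t * (cos t * 1) + sin t * (sin t * 1)) with 1.
  - exact sqrt_1.
  - pose proof (sin2_cos2 t) as H; unfold Rsqr in H; lra.
Qed.

Lemma Cmod_ray (t phi : R) : 0 <= t -> Cmod (RtoC t * cis phi)%C = t.
Proof.
  intros Ht; rewrite Cmod_mult, Cmod_cis, Cmod_R, Rabs_pos_eq; lra.
Qed.

Lemma Cmod_minus_ge (x y : C) : Cmod x - Cmod y <= Cmod (x - y)%C.
Proof.
  pose proof (Cmod_triangle (x - y) y) as H.
  replace (x - y + y)%C with x in H by ring; lra.
Qed.

Lemma Cmod_plus_ge (x y : C) : Cmod x - Cmod y <= Cmod (x + y)%C.
Proof.
  pose proof (Cmod_minus_ge x (- y)) as H; rewrite Cmod_opp in H.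
  replace (x - - y)%C with (x + y)%C in H by ring; exact H.
Qed.

Lemma locally_Cmod (p : C) (eps : R) :
  0 < eps -> locally (T := C_UniformSpace) p (fun w => Cmod (w - p)%C < eps).
Proof.
  intros He; assert (He2 : 0 < eps / 2) by lra.
  (* Balls of the product uniform structure are squares; half-side [eps / 2] puts the square in a
     disc of radius [sqrt 2 * (eps / 2) < eps]. *)
  exists (mkposreal _ He2); intros w Hw.
  apply C_NormedModule_mixin_compat2 in Hw; simpl in Hw.
  change (Cmod (w - p)%C < sqrt 2 * (eps / 2)) in Hw.
  assert (sqrt 2 < 2).
  { rewrite <- (sqrt_square 2) at 2 by lra; apply sqrt_lt_1; lra. }
  nra.
Qed.

Lemma locally_Cmod_inv (p : C) (P : C -> Prop) :
  locally (T := C_UniformSpace) p P ->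
  exists eps, 0 < eps /\ forall w, Cmod (w - p)%C < eps -> P w.
Proof.
  intros [eps H]; exists eps; split; [apply cond_pos|].
  intros w Hw; apply H, C_NormedModule_mixin_compat1, Hw.
Qed.

(** After division by [2 ^ n] the sequence is squeezed between [g - B / 2 ^ n] and
    [g + B / 2 ^ n]. *)
Lemma is_lim_seq_div_pow2 (a : nat -> R) (g B : R) :
  eventually (fun n => Rabs (a n - 2 ^ n * g) <= B) ->
  is_lim_seq (fun n => / 2 ^ n * a n) g.
Proof.
  intros Ha.
  assert (Hlim : forall s : R, is_lim_seq (fun n => g + s * (/ 2) ^ n) g).
  { intros s; replace (Finite g) with (Finite (g + s * 0)) by (f_equal; ring).
    apply is_lim_seq_plus'; [apply is_lim_seq_const|].
    apply (is_lim_seq_scal_l _ s 0), is_lim_seq_geom.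
    rewrite Rabs_pos_eq; lra. }
  apply (is_lim_seq_le_le_loc (fun n => g + - B * (/ 2) ^ n) _
           (fun n => g + B * (/ 2) ^ n)); [|apply Hlim|apply Hlim].
  destruct Ha as [N HN]; exists N; intros n Hn.
  specialize (HN n Hn); apply Rabs_le_between in HN.
  assert (Hp : 0 < 2 ^ n) by (apply pow_lt; lra).
  pose proof (Rinv_0_lt_compat _ Hp) as Hi.
  replace (/ 2 ^ n * a n) with (g + (a n - 2 ^ n * g) * / 2 ^ n) by (field; lra).
  rewrite pow_inv; nra.
Qed.

Lemma f_iter_S (K theta : R) (c z : C) (n : nat) :
  f_iter K theta c (S n) z = f K theta c (f_iter K theta c n z).
Proof. reflexivity. Qed.

Lemma f_iter_add (K theta : R) (c z : C) (m n : nat) :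
  f_iter K theta c m (f_iter K theta c n z) = f_iter K theta c (m + n) z.
Proof. symmetry; apply Nat.iter_add. Qed.

(** * Growth and boundedness of orbits *)

Section Dynamics.

Variables (K theta : R).
Hypothesis HK : 1 < K.

(** The two terms of [h] have moduli [(K + 1) / 2 * |z|] and [(K - 1) / 2 * |z|], with difference
    [|z|] and sum [K * |z|]. *)
Lemma Cmod_h_bounds (z : C) : Cmod z <= Cmod (h K theta z) <= K * Cmod z.
Proof.
  unfold h.
  set (u := (RtoC ((K + 1) / 2) * z)%C).
  set (v := (cis (2 * theta) * RtoC ((K - 1) / 2) * Cconj z)%C).
  assert (Hu : Cmod u = (K + 1) / 2 * Cmod z).
  { unfold u; rewrite Cmod_mult, Cmod_R, Rabs_pos_eq; lra. }
  assert (Hv : Cmod v = (K - 1) / 2 * Cmod z).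
  { unfold v; rewrite !Cmod_mult, Cmod_cis, Cmod_R, Cmod_conj, Rabs_pos_eq; lra. }
  pose proof (Cmod_triangle u v); pose proof (Cmod_plus_ge u v); lra.
Qed.

Lemma Cmod_f_ge (c z : C) : Cmod z * Cmod z - Cmod c <= Cmod (f K theta c z).
Proof.
  unfold f; pose proof (Cmod_plus_ge (h K theta z * h K theta z) c) as H.
  rewrite Cmod_mult in H.
  pose proof (Cmod_h_bounds z); pose proof (Cmod_ge_0 z); nra.
Qed.

Lemma Cmod_f0_le (z : C) :
  Cmod (f K theta (RtoC 0) z) <= K * K * (Cmod z * Cmod z).
Proof.
  unfold f; rewrite Cplus_0_r, Cmod_mult.
  pose proof (Cmod_h_bounds z); pose proof (Cmod_ge_0 z); nra.
Qed.

(** Beyond the radius [2 + |c|] one has [m * m - |c| >= 2 * m], so every step at least doubles the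
    modulus and stays beyond that radius. *)
Lemma Cmod_f_iter_ge (c z : C) (n : nat) :
  2 + Cmod c < Cmod z -> 2 ^ n * Cmod z <= Cmod (f_iter K theta c n z).
Proof.
  intros Hz; pose proof (Cmod_ge_0 c) as Hc.
  induction n as [|n IH]; [simpl; lra|].
  rewrite f_iter_S; simpl pow.
  assert (H1 : 1 <= 2 ^ n) by (apply pow_R1_Rle; lra).
  pose proof (Cmod_f_ge c (f_iter K theta c n z)) as Hf.
  set (m := Cmod (f_iter K theta c n z)) in *.
  assert (2 + Cmod c < m) by nra.
  assert (2 * m <= m * m - Cmod c) by nra.
  lra.
Qed.

Lemma escaping_of_large (c z : C) :
  2 + Cmod c < Cmod z -> escaping K theta c z.
Proof.
  intros Hz; pose proof (Cmod_ge_0 c) as Hc.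
  apply (is_lim_seq_le_p_loc (fun n => 2 ^ n)).
  - exists 0%nat; intros n _.
    pose proof (Cmod_f_iter_ge c z n Hz).
    assert (1 <= 2 ^ n) by (apply pow_R1_Rle; lra); nra.
  - apply is_lim_seq_geom_p; lra.
Qed.

Lemma escaping_f_iter (c z : C) (n : nat) :
  escaping K theta c (f_iter K theta c n z) <-> escaping K theta c z.
Proof.
  unfold escaping.
  rewrite (is_lim_seq_incr_n (fun m => Cmod (f_iter K theta c m z)) n).
  split; apply is_lim_seq_ext; intros m; now rewrite f_iter_add.
Qed.

Lemma not_escaping_bounded (c z : C) (n : nat) :
  ~ escaping K theta c z -> Cmod (f_iter K theta c n z) <= 2 + Cmod c.
Proof.
  intros Hz; apply Rnot_lt_le; intros H; apply Hz.
  apply (escaping_f_iter c z n), escaping_of_large, H.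
Qed.

(** On this disc [|f_0(z)| <= K^2 |z|^2 <= |z|], so the orbit never exceeds its initial modulus. *)
Lemma not_escaping_f0_small (z : C) :
  K * K * Cmod z <= 1 -> ~ escaping K theta (RtoC 0) z.
Proof.
  intros Hz Hesc.
  assert (Hb : forall n, Cmod (f_iter K theta (RtoC 0) n z) <= Cmod z).
  { induction n as [|n IH]; [apply Rle_refl|].
    rewrite f_iter_S.
    pose proof (Cmod_f0_le (f_iter K theta (RtoC 0) n z)) as Hf.
    set (m := Cmod (f_iter K theta (RtoC 0) n z)) in *.
    assert (0 <= m) by apply Cmod_ge_0.
    assert (K * K * m <= 1) by nra; nra. }
  (* Comparing limits gives [Rbar_le p_infty (Cmod z)], which computes to [False]. *)
  exact (is_lim_seq_le _ _ p_infty (Cmod z) Hb Hesc (is_lim_seq_const _)).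
Qed.

(** * The boundary of the escaping set of [f_0] *)

Lemma boundary_f0_bounds (p : C) :
  boundary (escaping K theta (RtoC 0)) p -> / (K * K) <= Cmod p <= 2.
Proof.
  intros Hp; split; apply Rnot_lt_le; intros H.
  (* A disc of this radius around [p] stays within modulus [/ (K * K)], where no point escapes. *)
  - assert (He : 0 < / (K * K) - Cmod p) by lra.
    destruct (proj1 (Hp _ (locally_Cmod p _ He))) as [w [Hw Hesc]].
    apply (not_escaping_f0_small w); [|exact Hesc].
    pose proof (Cmod_minus_ge w p).
    replace 1 with (K * K * / (K * K)) by (field; lra).
    apply Rmult_le_compat_l; nra.
  (* A disc of this radius around [p] stays beyond modulus 2, where every point escapes. *)
  - assert (He : 0 < Cmod p - 2) by lra.
    destruct (proj2 (Hp _ (locally_Cmod p _ He))) as [w [Hw Hesc]].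
    apply Hesc, escaping_of_large; rewrite Cmod_0.
    pose proof (Cmod_minus_ge p w).
    replace (p - w)%C with (- (w - p))%C in * by ring.
    rewrite Cmod_opp in *; lra.
Qed.

(* The outermost non-escaping point of the ray lies on the boundary. *)
Lemma ray_meets_boundary (phi : R) :
  exists p, on_ray phi p /\ boundary (escaping K theta (RtoC 0)) p.
Proof.
  set (E := fun t => 0 <= t /\ ~ escaping K theta (RtoC 0) (RtoC t * cis phi)%C).
  destruct (completeness E) as [t0 [Hub Hleast]].
  - exists 2; intros t [Ht Hesc].
    pose proof (not_escaping_bounded _ _ 0 Hesc) as H; unfold f_iter in H; simpl in H.
    rewrite Cmod_ray, Cmod_0 in H; lra.
  - exists 0; split; [lra|].
    apply not_escaping_f0_small; rewrite Cmod_ray; lra.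
  - assert (Ht0 : 0 <= t0).
    { apply Hub; split; [lra|].
      apply not_escaping_f0_small; rewrite Cmod_ray; lra. }
    assert (Hdist : forall s, Cmod (RtoC s * cis phi - RtoC t0 * cis phi)%C
                              = Rabs (s - t0)).
    { intros s.
      replace (RtoC s * cis phi - RtoC t0 * cis phi)%C
        with (RtoC (s - t0) * cis phi)%C by (rewrite RtoC_minus; ring).
      rewrite Cmod_mult, Cmod_cis, Cmod_R; ring. }
    exists (RtoC t0 * cis phi)%C; split; [now exists t0|].
    intros P HP; destruct (locally_Cmod_inv _ _ HP) as [eps [He HPe]]; split.
    + exists (RtoC (t0 + eps / 2) * cis phi)%C; split.
      * apply HPe; rewrite Hdist, Rabs_pos_eq; lra.
      * apply NNPP; intros Hn.
        assert (t0 + eps / 2 <= t0) by (apply Hub; split; [lra|exact Hn]); lra.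
    + apply NNPP; intros Hnone.
      (* Without non-escaping points near [t0], the smaller number [t0 - eps] would also bound [E],
         against the choice of [t0] as supremum. *)
      assert (t0 <= t0 - eps); [|lra].
      apply Hleast; intros t [Ht Hesc].
      assert (t <= t0) by (apply Hub; split; assumption).
      apply Rnot_lt_le; intros Hlt; apply Hnone.
      exists (RtoC t * cis phi)%C; split; [|exact Hesc].
      apply HPe; rewrite Hdist; apply Rabs_def1; lra.
Qed.

(** * Logarithmic asymptotics near infinity *)

Lemma Cmod_b_bounds (phi : R) : / (K * K) <= Cmod (b K theta phi) <= 2.
Proof.
  apply boundary_f0_bounds.
  exact (proj2 (epsilon_spec (inhabits (RtoC 0)) _ (ray_meets_boundary phi))).
Qed.

Lemma G0_log_asymptotics (w : C) :
  2 < Cmod w -> Rabs (G0 K theta w - ln (Cmod w)) <= ln 2 + ln (K * K).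
Proof.
  intros Hw; unfold G0.
  destruct (excluded_middle_informative _) as [_|Hn].
  2: { exfalso; apply Hn, escaping_of_large; rewrite Cmod_0; lra. }
  destruct (Cmod_b_bounds (Arg w)) as [Hlo Hhi].
  set (q := Cmod (b K theta (Arg w))) in *.
  assert (HKK : 1 < K * K) by nra.
  assert (Hi : 0 < / (K * K)) by (apply Rinv_0_lt_compat; lra).
  assert (Hq : 0 < q) by lra.
  rewrite ln_div by lra.
  apply (ln_le _ _ Hi) in Hlo; rewrite ln_Rinv in Hlo by lra.
  apply ln_le in Hhi; [|exact Hq].
  (* The error is [- ln q], between [- ln 2] and [ln (K * K)]; as both logarithms are positive,
     their sum bounds it in absolute value. *)
  assert (0 < ln 2) by (rewrite <- ln_1; apply ln_increasing; lra).
  assert (0 < ln (K * K)) by (rewrite <- ln_1; apply ln_increasing; lra).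
  apply Rabs_le; lra.
Qed.

Lemma boettcher_near_id (c : C) (psi : C -> C) :
  boettcher K theta c psi ->
  exists M, forall z, M < Cmod z -> Cmod (psi z - z)%C < 2.
Proof.
  intros (r & psis & _ & _ & _ & _ & _ & Hasym & Hunif).
  destruct (Hunif 1 Rlt_0_1) as [N HN].
  destruct (Hasym N 1 Rlt_0_1) as [M HM].
  exists (Rmax r M); intros z Hz.
  pose proof (Rmax_l r M); pose proof (Rmax_r r M).
  (* One map [psis (S N)] is within 1 of [psi] by uniform convergence and within 1 of the identity
     by normalisation; the latter is stated for successor indices. *)
  assert (H1 : Cmod (psis (S N) z - psi z)%C < 1) by (apply HN; [lia|lra]).
  assert (H2 : Cmod (psis (S N) z - z)%C < 1) by (apply HM; lra).
  replace (psi z - z)%C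
    with ((psis (S N) z - z) + - (psis (S N) z - psi z))%C by ring.
  eapply Rle_lt_trans; [apply Cmod_triangle|].
  rewrite Cmod_opp; lra.
Qed.

Lemma green_log_asymptotics (c : C) (psi : C -> C) (G : C -> R) :
  boettcher K theta c psi -> green K theta c psi G ->
  exists M B, forall w, M < Cmod w -> Rabs (G w - ln (Cmod w)) <= B.
Proof.
  intros Hpsi [[r HG] _].
  destruct (boettcher_near_id c psi Hpsi) as [M HM].
  (* As [psi] moves [w] by less than 2, [|w| > 4] gives [|psi w| > 2], and each modulus is at most
     twice the other. This costs the second [ln 2]. *)
  exists (Rmax (Rmax r M) 4), (2 * ln 2 + ln (K * K)); intros w Hw.
  apply Rmax_Rlt in Hw; destruct Hw as [Hw H4].
  apply Rmax_Rlt in Hw; destruct Hw as [Hr HMw].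
  rewrite (HG w Hr).
  specialize (HM w HMw).
  pose proof (Cmod_minus_ge (psi w) w) as Hup.
  assert (Hlow : Cmod w - Cmod (psi w) < 2).
  { pose proof (Cmod_minus_ge w (psi w)) as H.
    replace (w - psi w)%C with (- (psi w - w))%C in H by ring.
    rewrite Cmod_opp in H; lra. }
  assert (Hpw : 2 < Cmod (psi w)) by lra.
  pose proof (G0_log_asymptotics (psi w) Hpw) as H0.
  assert (L1 : ln (Cmod (psi w)) <= ln (2 * Cmod w)) by (apply ln_le; lra).
  assert (L2 : ln (Cmod w) <= ln (2 * Cmod (psi w))) by (apply ln_le; lra).
  rewrite ln_mult in L1, L2 by lra.
  apply Rabs_le_between in H0; apply Rabs_le; lra.
Qed.

Lemma green_f_iter (c : C) (psi : C -> C) (G : C -> R) (z : C) (n : nat) :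
  green K theta c psi G -> escaping K theta c z ->
  G (f_iter K theta c n z) = 2 ^ n * G z.
Proof.
  intros (_ & HG & _) Hz; induction n as [|n IH]; [simpl; ring|].
  rewrite f_iter_S, HG, IH; [simpl; ring|].
  now apply escaping_f_iter.
Qed.

End Dynamics.

Theorem proposition2p5 :
  forall (K theta : R) (c : C),
    1 < K -> - (PI / 2) < theta <= PI / 2 ->
  forall (psi : C -> C), boettcher K theta c psi ->
  forall (G : C -> R), green K theta c psi G ->
  forall z : C,
    is_lim_seq (fun n : nat => / 2 ^ n * log_plus (Cmod (f_iter K theta c n z)))
               (Finite (G z)).
Proof.
  intros K theta c HK _ psi Hpsi G HG z.
  destruct (classic (escaping K theta c z)) as [Hz|Hz].
  - destruct (green_log_asymptotics K theta HK c psi G Hpsi HG) as (M & B & HB).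
    apply (is_lim_seq_div_pow2 _ _ B).
    (* Beyond [M] the asymptotics hold; beyond 1, [log_plus] agrees with [ln]. *)
    destruct (proj2 (is_lim_seq_spec _ _) Hz (Rmax M 1)) as [N HN].
    exists N; intros n Hn.
    destruct (proj1 (Rmax_Rlt _ _ _) (HN n Hn)) as [HM H1].
    rewrite <- (green_f_iter K theta c psi G z n HG Hz).
    unfold log_plus; rewrite Rmax_left.
    + rewrite Rabs_minus_sym; now apply HB.
    + rewrite <- ln_1; apply ln_le; lra.
  - rewrite (proj2 (proj2 HG) z Hz).
    (* With limit 0 the error is [log_plus] itself, bounded along the bounded orbit. *)
    apply (is_lim_seq_div_pow2 _ _ (ln (2 + Cmod c))).
    exists 0%nat; intros n _.
    pose proof (not_escaping_bounded K theta HK c z n Hz) as Hb.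
    pose proof (Cmod_ge_0 c) as Hc.
    assert (Hln : 0 < ln (2 + Cmod c)) by (rewrite <- ln_1; apply ln_increasing; lra).
    rewrite Rmult_0_r, Rminus_0_r; unfold log_plus.
    rewrite Rabs_pos_eq by apply Rmax_r.
    apply Rmax_lub; [|lra].
    destruct (Cmod_ge_0 (f_iter K theta c n z)) as [Hpos|H0].
    + now apply ln_le.
    + (* Stdlib's junk value [ln 0 = 0]. *)
      rewrite <- H0; replace (ln 0) with 0; [lra|].
      unfold ln; destruct (Rlt_dec 0 0) as [H|]; [|reflexivity].
      destruct (Rlt_irrefl 0 H).
Qed.
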